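(* Let $n\ge2$ and let $\Omega$ be a bounded open domain in $\mathbb{H}^n$. Let $u,v\in C^0(\overline{\Omega})\cap C^2(\Omega)$ be such that the graphs $\Gamma_u$ and $\Gamma_v$ over $\Omega$ are space-like translators and $u=v$ on $\partial\Omega$. Then $u\equiv v$ in $\Omega$.
   Context: $\mathbb{H}^n$ is hyperbolic space with its metric $g_{\mathbb{H}^n}$, and the ambient space is $\mathbb{H}^n\times\mathbb{R}$ with the Lorentzian metric $g_{\mathbb{H}^n}-dt^2$. For $u\in C^2(\Omega)$, the graph $\Gamma_u(p)=(p,u(p))$ is space-like if $|\nabla u|<1$ on $\Omega$ (gradient, norm and divergence with respect to $g_{\mathbb{H}^n}$). A space-like graph is a translator if its mean curvature vector (trace of the second fundamental form) equals $\partial_t^\perp$, the normal projection of $\partial_t$; equivalently, on $\Omega$, $$\mathrm{div}\left(\frac{\nabla u}{\sqrt{1-|\nabla u|^2}}\right)=\frac{1}{\sqrt{1-|\nabla u|^2}}.$$ *)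

(* Defs.v *)
(* Hyperbolic space H^n is the Poincare ball model: the open Euclidean unit ball
   of R^n with the metric 4 |dx|^2 / (1 - |x|^2)^2.  The extrinsic geometry of a
   graph is that of an immersion into a semi-Riemannian manifold covered by one
   chart, computed in coordinates. *)
From mathcomp Require Import all_boot all_order all_algebra.
From mathcomp Require Import all_classical all_reals all_analysis.
Import Order.TTheory GRing.Theory Num.Theory.
Import numFieldNormedType.Exports.

Set Implicit Arguments.
Unset Strict Implicit.
Unset Printing Implicit Defensive.

Local Open Scope classical_set_scope.
Local Open Scope ring_scope.

Section Calculus.
Context {R : realType} {n : nat}.

Definition partial {V : normedModType R} (i : 'I_n) (f : 'rV[R]_n -> V)
    (x : 'rV[R]_n) : V :=
  'D_(delta_mx 0 i) f x.

Definition C1_on (U : set 'rV[R]_n) (f : 'rV[R]_n -> R) : Prop :=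
  forall (i : 'I_n) (x : 'rV[R]_n), U x ->
    derivable f x (delta_mx 0 i) /\ {for x, continuous (partial i f)}.

Definition C2_on (U : set 'rV[R]_n) (f : 'rV[R]_n -> R) : Prop :=
  C1_on U f /\ forall i : 'I_n, C1_on U (partial i f).

End Calculus.

(* A semi-Riemannian metric on (an open subset of) R^m is given by its Gram
   matrix [G p] in the coordinate frame at each point [p]; tangent vectors are
   row vectors of coordinates. *)
Section SemiRiemannian.
Context {R : realType} {m : nat}.

Definition inner (A : 'M[R]_m) (X Y : 'rV[R]_m) : R := (X *m A *m Y^T) 0 0.

Variable G : 'rV[R]_m -> 'M[R]_m.

Definition grad (f : 'rV[R]_m -> R) (p : 'rV[R]_m) : 'rV[R]_m :=
  \row_i \sum_j invmx (G p) i j * partial j f p.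

(* Only meaningful where [G p] is positive definite. *)
Definition metric_norm (p X : 'rV[R]_m) : R := Num.sqrt (inner (G p) X X).

(* [christoffel p k i j] is Gamma^k_{ij} of the Levi-Civita connection. *)
Definition christoffel (p : 'rV[R]_m) (k i j : 'I_m) : R :=
  2^-1 * \sum_l invmx (G p) k l *
    (partial i (fun q => G q j l) p + partial j (fun q => G q i l) p
     - partial l (fun q => G q i j) p).

Section Immersion.
Context {n : nat} (F : 'rV[R]_n -> 'rV[R]_m).

Definition first_form (x : 'rV[R]_n) : 'M[R]_n :=
  \matrix_(i, j) inner (G (F x)) (partial i F x) (partial j F x).

(* Ambient covariant derivative of the tangent field [partial j F] along
   [partial i F]. *)
Definition ambient_cov (x : 'rV[R]_n) (i j : 'I_n) : 'rV[R]_m :=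
  partial i (partial j F) x +
  \row_k \sum_a \sum_b christoffel (F x) k a b *
                       partial i F x 0 a * partial j F x 0 b.

(* Subtracts from [V] its tangential part; meaningful where the first
   fundamental form is nondegenerate. *)
Definition normal_proj (x : 'rV[R]_n) (V : 'rV[R]_m) : 'rV[R]_m :=
  V - \sum_i \sum_j (invmx (first_form x) i j *
                     inner (G (F x)) V (partial j F x)) *: partial i F x.

Definition second_form (x : 'rV[R]_n) (i j : 'I_n) : 'rV[R]_m :=
  normal_proj x (ambient_cov x i j).

(* The trace itself, not divided by [n]. *)
Definition mean_curvature_vector (x : 'rV[R]_n) : 'rV[R]_m :=
  \sum_i \sum_j invmx (first_form x) i j *: second_form x i j.

End Immersion.
End SemiRiemannian.

Section HyperbolicSpace.
Context {R : realType} {n : nat}.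

(* The norm [`|x|] of the library on row vectors is the sup norm. *)
Definition sqnorm (x : 'rV[R]_n) : R := \sum_i x 0 i ^+ 2.

Definition hyp_space : set 'rV[R]_n := [set x | sqnorm x < 1].

Definition hyp_metric (x : 'rV[R]_n) : 'M[R]_n :=
  (4 / (1 - sqnorm x) ^+ 2)%:M.

Definition arcosh (z : R) : R := ln (z + Num.sqrt (z ^+ 2 - 1)).

(* The Riemannian distance of [hyp_metric] in closed form. *)
Definition hyp_dist (x y : 'rV[R]_n) : R :=
  arcosh (1 + 2 * sqnorm (x - y) / ((1 - sqnorm x) * (1 - sqnorm y))).

(* The topology of H^n is the one induced by R^n, so openness and
   connectedness can be tested in R^n. *)
Definition hyp_bounded_domain (Omega : set 'rV[R]_n) : Prop :=
  [/\ Omega `<=` hyp_space, Omega !=set0, open Omega, connected Omega &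
      exists C : R, forall x y, Omega x -> Omega y -> hyp_dist x y <= C].

Definition hyp_closure (Omega : set 'rV[R]_n) : set 'rV[R]_n :=
  closure Omega `&` hyp_space.

Definition hyp_boundary (Omega : set 'rV[R]_n) : set 'rV[R]_n :=
  hyp_closure Omega `\` interior Omega.

End HyperbolicSpace.

Section Translators.
Context {R : realType} {n : nat}.

(* The metric g - dt^2 on H^n x R; the last coordinate is t. *)
Definition lorentz_metric (p : 'rV[R]_(n + 1)) : 'M[R]_(n + 1) :=
  block_mx (hyp_metric (lsubmx p)) 0 0 (- 1%:M).

Definition graph (u : 'rV[R]_n -> R) (x : 'rV[R]_n) : 'rV[R]_(n + 1) :=
  row_mx x (u x)%:M.

Definition d_t : 'rV[R]_(n + 1) := row_mx 0 1%:M.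

Definition space_like (Omega : set 'rV[R]_n) (u : 'rV[R]_n -> R) : Prop :=
  forall x, Omega x -> metric_norm hyp_metric x (grad hyp_metric u x) < 1.

Definition translator (Omega : set 'rV[R]_n) (u : 'rV[R]_n -> R) : Prop :=
  forall x, Omega x ->
    mean_curvature_vector lorentz_metric (graph u) x =
    normal_proj lorentz_metric (graph u) x d_t.

End Translators.

(* Main.v *)
Require Import Defs.
From mathcomp Require Import all_boot all_order all_algebra.
From mathcomp Require Import all_classical all_reals all_analysis.
From mathcomp Require Import ring lra.
Import Order.TTheory GRing.Theory Num.Theory.
Import numFieldNormedType.Exports.

Local Open Scope classical_set_scope.
Local Open Scope ring_scope.

(** Pairing the translator equation with a covector that annihilates the tangent
    space of the graph turns it into a scalar equation [F(x, Du, D^2 u) = 0] that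
    is elliptic where the graph is space-like, affine in [D^2 u], and has no
    zero-order term.  If [m = u(x1) - v(x1) > 0], then on the compact subset
    [{u - v >= m / 2}] of Omega the ellipticity is uniform and all coefficients
    are bounded.  For small [eps] the maximum of [u - v + eps exp(a x_k)] over the
    closure of Omega lies in that set; there [Du = Dv - s e_k] and
    [D^2 u <= D^2 v - a s e_k e_k^T] with [s = a eps exp(a x_k)], so ellipticity
    gains [a s c] in [F] whereas the change of gradient costs at most [B s], with
    [B] and [c > 0] independent of [a]: a contradiction for large [a]. *)

(** * Derivatives along lines and the mean value theorem *)

(** Both difference quotients are the same function of the increment; one-variable calculus thus
    applies to directional derivatives. *)
Lemma is_derive_line (R : realType) (V W : normedModType R) (f : V -> W)
    (x v : V) (t : R) (df : W) :
  is_derive (x + t *: v) v f df <->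
  is_derive t 1 (fun s : R => f (x + s *: v)) df.
Proof.
have E : (fun h : R =>
      h^-1 *: ((f \o shift (x + t *: v)) (h *: v) - f (x + t *: v))) =
    (fun h : R => h^-1 *: (((fun s : R => f (x + s *: v)) \o shift t) (h *: 1)
      - f (x + t *: v))).
  by apply/funext => h /=; rewrite addrCA -scalerDl [h *: 1]mulr1.
split=> -[d1 d2]; split.
- by rewrite /derivable -E.
- by rewrite /derive -E.
- by rewrite /derivable E.
- by rewrite /derive E.
Qed.

(** Increments of either sign, zero included, are allowed because [a] will be a coordinate of an
    arbitrary displacement. *)
Lemma MVT_signed (R : realType) (g dg : R -> R) (a : R) :
  (forall t : R, `|t| <= `|a| -> is_derive (t : R) 1 g (dg t)) ->
  exists2 c, `|c| <= `|a| & g a - g 0 = a * dg c.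
Proof.
move=> gd; case: (ltrgtP a 0) => a0; last first.
- by exists 0; rewrite ?normr0 // a0 subrr mul0r.
- have [||c] := @MVT R g dg 0 a a0.
  + by move=> t; rewrite in_itv/= => /andP[t0 ta]; apply: gd;
      rewrite !gtr0_norm // ltW.
  + apply: derivable_within_continuous => t; rewrite in_itv/= => /andP[t0 ta].
    by have [] : is_derive t 1 g (dg t) by apply: gd; rewrite !ger0_norm // ltW.
  + rewrite in_itv/= => /andP[c0 ca] ->; rewrite subr0 mulrC; exists c => //.
    by rewrite !gtr0_norm // ltW.
- have [||c] := @MVT R g dg a 0 a0.
  + by move=> t; rewrite in_itv/= => /andP[t0 ta]; apply: gd;
      rewrite !ltr0_norm // lerN2 ltW.
  + apply: derivable_within_continuous => t; rewrite in_itv/= => /andP[t0 ta].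
    by have [] : is_derive t 1 g (dg t) by apply: gd;
      rewrite !ler0_norm ?lerN2 // ltW.
  + rewrite in_itv/= => /andP[c0 ca] E; exists c;
      first by rewrite !ltr0_norm // lerN2 ltW.
    by rewrite -opprB E sub0r; ring.
Qed.

(** * Continuous partial derivatives imply differentiability *)

Section C1.
Context {R : realType} {n : nat}.
Implicit Types (U : set 'rV[R]_n) (f : 'rV[R]_n -> R).

(** The points [trunc h 0 = 0], ..., [trunc h n = h] are the vertices of a staircase path whose
    edges are parallel to the coordinate axes. *)
Let trunc (h : 'rV[R]_n) (k : nat) : 'rV[R]_n :=
  \row_j (if (j < k)%N then h 0 j else 0).

Lemma ler_norm_rV {m : nat} (h : 'rV[R]_m) (c : R) : 0 <= c ->
  (forall i, `|h 0 i| <= c) -> `|h| <= c.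
Proof.
move=> c0 hc; rewrite [leLHS]/Num.Def.normr/= mx_normrE.
by apply: bigmax_le => // -[i j] _ /=; rewrite ord1.
Qed.

Lemma ler_coord_norm {m : nat} (h : 'rV[R]_m) (i : 'I_m) : `|h 0 i| <= `|h|.
Proof.
rewrite [leRHS]/Num.Def.normr/= mx_normrE.
exact: (le_bigmax _ (fun ij : 'I_1 * 'I_m => `|h ij.1 ij.2|) (0, i)).
Qed.

(** The increment of [f] telescopes along the staircase from [x] to [x + h]. On edge [k] the mean
    value theorem gives the [k]-th partial derivative at an intermediate point, which is close to
    its value at [x] by continuity. *)
Lemma C1_on_estimate U f x : open U -> C1_on U f -> U x ->
  forall e, 0 < e -> \forall h \near (0 : 'rV[R]_n),
    `|f (x + h) - f x - \sum_i h 0 i * partial i f x| <= e * `|h|.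
Proof.
move=> Uo fC1 Ux e e0.
(* Each of the [n] edges contributes an error of at most [e' * |h|]; the successor keeps the
   denominator positive when [n = 0]. *)
pose e' := e / n.+1%:R.
have e'0 : 0 < e' by rewrite divr_gt0.
have /nbhs_ballP[d /= d0 dP] : \forall h \near (0 : 'rV[R]_n),
    U (x + h) /\ forall i, `|partial i f (x + h) - partial i f x| <= e'.
  have xh : x + h @[h --> (0 : 'rV[R]_n)] --> x.
    rewrite -[X in _ --> X]addr0.
    by apply: (@cvgD _ _ _ (nbhs (0 : 'rV[R]_n))); [exact: cvg_cst|exact: cvg_id].
  have xU : nbhs x U by apply: open_nbhs_nbhs; split.
  have N1 : \forall h \near (0 : 'rV[R]_n), U (x + h) := xh _ xU.
  have N2 : \forall h \near (0 : 'rV[R]_n),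
      forall i, `|partial i f (x + h) - partial i f x| <= e'.
    apply: (@filter_forall _ _ (fun i (h : 'rV[R]_n) =>
      `|partial i f (x + h) - partial i f x| <= e') (nbhs (0 : 'rV[R]_n))) => i.
    have [_ ci] := fC1 i x Ux.
    have /cvgrPdist_le/(_ _ e'0) := cvg_comp _ _ xh ci.
    by apply: filterS => h; rewrite distrC.
  by near=> h; split; [near: h|near: h].
apply/nbhs_ballP; exists d => //= h; rewrite -ball_normE /= sub0r normrN => hd.
have step (k : 'I_n) : `|f (x + trunc h k.+1) - f (x + trunc h k) -
    h 0 k * partial k f x| <= e' * `|h|.
  have tr c : trunc h k + c *: delta_mx 0 k =
      \row_j (if (j < k)%N then h 0 j else if j == k then c else 0).
    apply/rowP => j; rewrite !mxE eqxx /=.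
    case: eqVneq => [->|jk]; first by rewrite ltnn mulr1 add0r.
    by rewrite mulr0 addr0.
  have trS : trunc h k.+1 = trunc h k + h 0 k *: delta_mx 0 k.
    rewrite tr; apply/rowP => j; rewrite !mxE ltnS leq_eqVlt.
    case: (eqVneq j k) => [->|jk]; first by rewrite eqxx ltnn.
    by rewrite (_ : (j == k :> nat) = false) //; apply/negbTE.
  (* In the sup norm, points of the staircase are no farther from the origin than [h]. *)
  have near_x c : `|c| <= `|h 0 k| -> `|trunc h k + c *: delta_mx 0 k| < d.
    move=> ch; apply: le_lt_trans hd; apply: ler_norm_rV => // j; rewrite tr !mxE.
    case: ifP => _; first exact: ler_coord_norm.
    case: ifP => _; last by rewrite normr0.
    exact: le_trans ch (ler_coord_norm _ _).
  have near_U c : `|c| <= `|h 0 k| -> U (x + (trunc h k + c *: delta_mx 0 k)) /\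
      `|partial k f (x + (trunc h k + c *: delta_mx 0 k)) - partial k f x| <= e'.
    move=> /near_x ch; have [|cU cP] := dP (trunc h k + c *: delta_mx 0 k).
      by rewrite -ball_normE /= sub0r normrN.
    by split.
  have [|c ch] := @MVT_signed R (fun s => f (x + trunc h k + s *: delta_mx 0 k))
      (fun s => partial k f (x + trunc h k + s *: delta_mx 0 k)) (h 0 k).
    move=> t th; apply: (is_derive_line _ _ _ f _ _ _ _).1; apply: derivableP.
    by rewrite -addrA; have [] := fC1 k _ (near_U t th).1.
  rewrite scale0r addr0 -(addrA x (trunc h k) (h 0 k *: _)) -trS => ->.
  rewrite -(addrA x) -mulrBr normrM mulrC.
  by apply: ler_pM => //; [exact: (near_U c ch).2|exact: ler_coord_norm].
have tele : f (x + h) - f x =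
    \sum_(k < n) (f (x + trunc h k.+1) - f (x + trunc h k)).
  rewrite -(big_mkord xpredT (fun k => f (x + trunc h k.+1) - f (x + trunc h k))).
  rewrite telescope_sumr //; congr (f (_ + _) - f _).
    by apply/rowP => j; rewrite !mxE ltn_ord.
  by rewrite -[LHS]addr0; congr (_ + _); apply/rowP => j; rewrite !mxE.
rewrite tele -sumrB; apply: le_trans (ler_norm_sum _ _ _) _.
apply: le_trans (ler_sum _ (fun k _ => step k)) _.
rewrite sumr_const card_ord -[X in X <= _]mulr_natl mulrA ler_wpM2r //.
by rewrite /e' mulrCA ler_piMr ?(ltW e0) // ler_pdivrMr // mul1r ler_nat.
Unshelve. all: by end_near. Qed.

Lemma C1_on_is_derive U f x v : open U -> C1_on U f -> U x ->
  is_derive x v f (\sum_i v 0 i * partial i f x).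
Proof.
move=> Uo fC1 Ux.
set l := \sum_i _.
suff cv : h^-1 *: (f (h *: v + x) - f x) @[h --> 0^'] --> l.
  by apply: DeriveDef; [apply/cvg_ex; exists l|apply/cvg_lim].
apply/cvgrPdist_le => /= e e0.
(* The added 1 covers the case [v = 0]. *)
pose e' := e / (`|v| + 1).
have v1 : 0 < `|v| + 1 by rewrite ltr_wpDl.
have e'0 : 0 < e' by rewrite divr_gt0.
have hv : h *: v @[h --> 0^'] --> (0 : 'rV[R]_n).
  rewrite -[X in _ --> X](scale0r v); apply: cvgZr_tmp; exact: cvg_within.
have est := hv _ (C1_on_estimate U f x Uo fC1 Ux e' e'0).
near=> h.
have h0 : h != 0 by near: h; exact: nbhs_dnbhs_neq.
have : `|f (x + h *: v) - f x - \sum_i (h *: v) 0 i * partial i f x|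
     <= e' * `|h *: v| by near: h; exact: est.
have -> : \sum_i (h *: v) 0 i * partial i f x = h * l.
  by rewrite mulr_sumr; apply: eq_bigr => i _; rewrite mxE mulrA.
rewrite normrZ mulrCA => H.
rewrite distrC (addrC _ x).
have -> : h^-1 *: (f (x + h *: v) - f x) - l =
    h^-1 * (f (x + h *: v) - f x - h * l).
  by rewrite mulrBr mulKf.
rewrite normrM normfV ler_pdivrMl ?normr_gt0 //; apply: le_trans H _.
rewrite ler_wpM2l // /e' -mulrA ler_piMr ?(ltW e0) // mulrC ler_pdivrMr //.
by rewrite mul1r lerDl.
Unshelve. all: by end_near. Qed.

Lemma C1_on_is_derive_line U f x v t : open U -> C1_on U f -> U (x + t *: v) ->
  is_derive t 1 (fun s : R => f (x + s *: v))
    (\sum_i v 0 i * partial i f (x + t *: v)).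
Proof.
move=> Uo fC1 Ux; apply: (is_derive_line _ _ _ f _ _ _ _).1.
exact: (C1_on_is_derive U).
Qed.

End C1.

(* If [g'' 0 > 0] then [g'] is positive just to the right of its zero [0], so
   [g] increases strictly there. *)
Lemma second_derivative_test (R : realType) (g dg : R -> R) (ddg : R) :
  (\forall t \near (0 : R), is_derive (t : R) 1 g (dg t)) ->
  is_derive (0 : R) 1 dg ddg ->
  (\forall t \near (0 : R), g t <= g 0) ->
  dg 0 = 0 /\ ddg <= 0.
Proof.
move=> gd dgd gmax.
have dg0 : dg 0 = 0.
  have [d /= d0 dP] := filterI gd gmax.
  have inb t : t \in `]- d, d[ -> ball (0 : R) d t.
    by rewrite in_itv/= -ball_normE /= sub0r normrN ltr_norml.
  have [||||_ g0] := @derive1_at_max R g (- d) d 0.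
  - lra.
  - by move=> t /inb /dP[[]].
  - by rewrite in_itv/=; apply/andP; split; lra.
  - by move=> t /inb /dP[].
  by have [[_ <-] _] := dP 0 (ballxx _ d0).
split=> //; rewrite leNgt; apply/negP => pos.
have dpos : \forall h \near (0 : R), h != 0 -> 0 < h^-1 * dg h.
  case: dgd => dv dE; rewrite -{}dE in pos.
  have E : (fun h : R => h^-1 *: ((dg \o shift 0) (h *: 1) - dg 0)) =
      (fun h => h^-1 * dg h).
    by apply/funext => h; rewrite /= dg0 addr0 subr0 [h *: 1]mulr1.
  have {}dv : h^-1 * dg h @[h --> (0 : R)^'] --> 'D_1 dg (0 : R).
    by move: dv; rewrite /derivable /derive E.
  have := @cvgr_gt R _ _ _ _ _ dv 0 pos.
  by move=> /(_ (dnbhs_filter _)); rewrite near_withinE.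
have [d /= d0 dP] := filterI (filterI gd gmax) dpos.
pose b := d / 2.
have b0 : 0 < b by rewrite /b; lra.
have inb t : 0 <= t -> t <= b -> ball (0 : R) d t.
  move=> t0 tb; rewrite -ball_normE /= sub0r normrN ger0_norm //.
  by apply: le_lt_trans tb _; rewrite /b; lra.
have [||c] := @MVT R g dg 0 b b0.
- move=> t; rewrite in_itv/= => /andP[t0 tb].
  by have [[]] := dP t (inb _ (ltW t0) (ltW tb)).
- apply: derivable_within_continuous => t; rewrite in_itv/= => /andP[t0 tb].
  by have [[[]]] := dP t (inb _ t0 tb).
rewrite in_itv/= => /andP[c0 cb] E.
have [_ /(_ (lt0r_neq0 c0))] := dP c (inb _ (ltW c0) (ltW cb)).
rewrite pmulr_rgt0 ?invr_gt0 // => dc.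
have [[_ gb] _] := dP b (inb _ (ltW b0) (lexx _)).
have : 0 < g b - g 0 by rewrite E subr0 mulr_gt0.
by rewrite subr_gt0 ltNge gb.
Qed.

(** * Matrix inverses and entrywise derivatives *)

Section Matrix.
Context {R : realType}.

Lemma invmx_eq {n : nat} (A B : 'M[R]_n) : A *m B = 1%:M -> invmx A = B.
Proof.
move=> AB; have [uA _] := mulmx1_unit AB.
by rewrite -[RHS](mulKmx uA) AB mulmx1.
Qed.

Lemma is_derive_mx {V : normedModType R} {m n : nat} (M : V -> 'M[R]_(m, n))
    (x v : V) (dM : 'M[R]_(m, n)) :
  (forall i j, is_derive x v (fun y => M y i j) (dM i j)) -> is_derive x v M dM.
Proof.
move=> dMP; have dM' : derivable M x v.
  by apply/derivable_mxP => i j; have [] := dMP i j.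
apply: DeriveDef => //; rewrite derive_mx //; apply/matrixP => i j; rewrite mxE.
by have [_] := dMP i j.
Qed.

Lemma is_derive_coord {n : nat} (x v : 'rV[R]_n) (i : 'I_n) :
  is_derive x v (fun y : 'rV[R]_n => y 0 i) (v 0 i).
Proof.
have dv : derivable (id : 'rV[R]_n -> 'rV[R]_n) x v by exact: derivable_id.
split; first exact: ((derivable_mxP _ _ _).1 dv).
have := derive_mx dv; rewrite derive_id => /rowP /(_ i).
by rewrite mxE => <-.
Qed.

Lemma sum_delta {n : nat} (i : 'I_n) (F : 'I_n -> R) :
  \sum_j F j * (i == j)%:R = F i.
Proof.
rewrite (bigD1 i) //= eqxx mulr1 big1 ?addr0 // => j ji.
by rewrite eq_sym (negPf ji) mulr0.
Qed.

Lemma mulmx_trmx_sqnorm {n : nat} (p : 'rV[R]_n) : p *m p^T = (sqnorm p)%:M.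
Proof.
apply/matrixP => i j; rewrite !ord1 !mxE /= mulr1n.
by apply: eq_bigr => k _; rewrite mxE expr2.
Qed.

(** The Sherman-Morrison formula, from [p *m p^T = (sqnorm p)%:M]. The first fundamental form of a
    graph with Euclidean gradient [p] has this shape, with [lam] the conformal factor. *)
Lemma invmx_rank1_perturbation {n : nat} (p : 'rV[R]_n) (lam : R) :
  lam != 0 -> lam - sqnorm p != 0 ->
  invmx (lam%:M - p^T *m p) = lam^-1 *: (1%:M + (lam - sqnorm p)^-1 *: (p^T *m p)).
Proof.
move=> l0 D0; apply: invmx_eq.
rewrite -scalemxAr mulmxDr mulmx1 -scalemxAr mulmxBl mul_scalar_mx.
rewrite -mulmxA (mulmxA p) mulmx_trmx_sqnorm mul_scalar_mx -scalemxAr -scalerBl scalerA.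
by rewrite mulVf // scale1r subrK scale_scalar_mx mulVf.
Qed.

End Matrix.

(** * The conformal factor of the ball model *)

Section Conformal.
Context {R : realType} {n : nat}.
Implicit Types x v : 'rV[R]_n.

(* [hyp_metric x = (conf x)%:M] and [dlog x i] is half the [i]-th partial
   derivative of [ln conf] at [x]. *)
Definition conf x : R := 4 / (1 - sqnorm x) ^+ 2.

Definition dlog x : 'rV[R]_n := (2 / (1 - sqnorm x)) *: x.

Lemma conf_gt0 x : hyp_space x -> 0 < conf x.
Proof. by move=> hx; rewrite /conf divr_gt0 // exprn_gt0 // subr_gt0. Qed.

(** The index map [l] makes it possible to sum over only the horizontal coordinates of a point of
    the product space. *)
Lemma is_derive_sum_sqr {m : nat} (l : 'I_n -> 'I_m) (q w : 'rV[R]_m) :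
  is_derive q w (fun y : 'rV[R]_m => \sum_i y 0 (l i) ^+ 2)
    (\sum_i 2 * q 0 (l i) * w 0 (l i)).
Proof.
have -> : (fun y : 'rV[R]_m => \sum_i y 0 (l i) ^+ 2) =
    \sum_(i < n) ((fun y : 'rV[R]_m => y 0 (l i)) ^+ 2).
  by apply/funext => y; rewrite fct_sumE; apply: eq_bigr => i _.
apply: is_derive_sum => i; apply: (is_derive_eq (df := _)).
  exact/is_deriveX/is_derive_coord.
by rewrite expr1 [_ *: _]/(_ * _) -mulr_natl.
Qed.

End Conformal.

(** * The Levi-Civita connection of the Lorentzian product *)

Section Lorentz.
Context {R : realType} {n : nat}.

Lemma sqnorm_lsub (q : 'rV[R]_(n + 1)) :
  sqnorm (lsubmx q) = \sum_i q 0 (lshift 1 i) ^+ 2.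
Proof. by apply: eq_bigr => i _; rewrite mxE. Qed.

Lemma is_derive_conf (q w : 'rV[R]_(n + 1)) : hyp_space (lsubmx q) ->
  is_derive q w (fun y : 'rV[R]_(n + 1) => conf (lsubmx y))
    (2 * conf (lsubmx q) * \sum_i dlog (lsubmx q) 0 i * w 0 (lshift 1 i)).
Proof.
rewrite /hyp_space /= => hq.
pose g : 'rV[R]_(n + 1) -> R := fun y => 1 - sqnorm (lsubmx y).
have g0 : g q != 0 by rewrite /g subr_eq0 gt_eqF.
have dg : is_derive q w g (- \sum_i 2 * q 0 (lshift 1 i) * w 0 (lshift 1 i)).
  have -> : g = cst 1 - (fun y => \sum_i y 0 (lshift 1 i) ^+ 2).
    by apply/funext => y; rewrite /g sqnorm_lsub.
  rewrite -[X in is_derive _ _ _ X]add0r; apply: is_deriveB; first exact: is_derive_cst.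
  exact: is_derive_sum_sqr.
have [dg2 dg2E] : is_derive q w (fun y => g y ^+ 2)
    (- (2 * g q) * \sum_i 2 * q 0 (lshift 1 i) * w 0 (lshift 1 i)).
  by have := is_deriveX 2 dg; rewrite expr1 scalerN -scaleNr.
have g20 : g q ^+ 2 != 0 by rewrite expf_eq0.
have -> : (fun y : 'rV[R]_(n + 1) => conf (lsubmx y)) =
    4 *: (fun y => (g y ^+ 2)^-1) by [].
apply: is_derive_eq.
  apply: is_deriveZ; split; first exact: derivableV.
  exact: deriveV.
rewrite dg2E /conf /dlog -[1 - sqnorm _]/(g q) !mulr_sumr !scaler_sumr.
apply: eq_bigr => i _; rewrite !mxE.
move: (g q) (q 0 _) (w 0 _) g0 => a b c a0.
transitivity (4 * (- (a ^+ 2) ^- 2 * (- (2 * a) * (2 * b * c)))) => //.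
by field.
Qed.

(** [horiz] and [vert] are the projections onto the two factors. The metric and its inverse are
    combinations of them, so index computations reduce to the algebra of complementary
    idempotents. *)
Definition horiz : 'M[R]_(n + 1) := block_mx 1%:M 0 0 0.
Definition vert : 'M[R]_(n + 1) := block_mx 0 0 0 1%:M.

Lemma lorentz_metricE (q : 'rV[R]_(n + 1)) :
  lorentz_metric q = conf (lsubmx q) *: horiz - vert.
Proof.
rewrite /lorentz_metric /horiz /vert scale_block_mx opp_block_mx add_block_mx.
by rewrite !scaler0 !oppr0 !addr0 add0r scalemx1.
Qed.

Lemma invmx_lorentz (q : 'rV[R]_(n + 1)) : hyp_space (lsubmx q) ->
  invmx (lorentz_metric q) = (conf (lsubmx q))^-1 *: horiz - vert.
Proof.
move=> /conf_gt0 /lt0r_neq0 c0; apply: invmx_eq.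
rewrite lorentz_metricE /horiz /vert !scale_block_mx !opp_block_mx !add_block_mx.
rewrite !scaler0 !oppr0 !addr0 !add0r mulmx_block !mulmx0 !mul0mx !addr0.
rewrite !add0r -scalemxAl mul1mx scalerA mulfV // scale1r mulmxN mulNmx opprK.
by rewrite mulmx1 -scalar_mx_block.
Qed.

(* [dlog] extended by zero to the vertical direction. *)
Definition dlog1 (x : 'rV[R]_n) : 'rV[R]_(n + 1) := row_mx (dlog x) 0.

Lemma partial_lorentz (q : 'rV[R]_(n + 1)) (i j l : 'I_(n + 1)) :
  hyp_space (lsubmx q) ->
  partial i (fun y : 'rV[R]_(n + 1) => lorentz_metric y j l) q =
  2 * conf (lsubmx q) * dlog1 (lsubmx q) 0 i * horiz j l.
Proof.
move=> hq.
have -> : (fun y : 'rV[R]_(n + 1) => lorentz_metric y j l) =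
    horiz j l *: (fun y => conf (lsubmx y)) + cst (- vert j l).
  apply/funext => y; rewrite lorentz_metricE !mxE mulrC.
  by [].
have [_] := is_deriveD (is_deriveZ (horiz j l) (is_derive_conf q (delta_mx 0 i) hq))
    (is_derive_cst (- vert j l) q (delta_mx 0 i)).
rewrite /partial => ->; rewrite addr0 [horiz j l *: _]/(horiz j l * _) [LHS]mulrC.
do 2 congr (_ * _).
case: (split_ordP i) => k ->; rewrite ?row_mxEl ?row_mxEr.
  under eq_bigr => m _ do
    rewrite [delta_mx _ _ _ _]mxE eqxx (inj_eq (@lshift_inj _ _)) eq_sym.
  exact: sum_delta.
rewrite [RHS]mxE big1 // => m _; rewrite [delta_mx _ _ _ _]mxE eq_lrshift andbF.
exact: mulr0.
Qed.

Lemma horiz_tr j l : horiz j l = horiz l j.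
Proof.
have -> : horiz j l = horiz^T l j by rewrite [RHS]mxE.
by rewrite /horiz tr_block_mx trmx1 !trmx0.
Qed.

Lemma horiz_idem : horiz *m horiz = horiz.
Proof.
by rewrite /horiz mulmx_block !mul1mx !mul0mx ?mulmx0 !addr0.
Qed.

Lemma vert_horiz : vert *m horiz = 0.
Proof.
rewrite /horiz /vert mulmx_block !mul1mx !mul0mx ?mulmx0 !addr0.
by rewrite -block_mx0.
Qed.

Lemma dlog1_horiz x : dlog1 x *m horiz = dlog1 x.
Proof.
by rewrite /horiz /dlog1 mul_row_block !mulmx1 !mulmx0 !addr0.
Qed.

Lemma dlog1_vert x : dlog1 x *m vert = 0.
Proof.
by rewrite /vert /dlog1 mul_row_block !mulmx0 mul0mx !addr0 row_mx0.
Qed.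

(** The formula for a metric conformal to the Euclidean one, with [dlog] the differential of half
    the logarithm of the factor. The derivatives of the metric involve only [horiz] and [dlog1], on
    which the inverse metric acts as the inverse conformal factor; every symbol with a vertical
    index vanishes. *)
Lemma christoffel_lorentz (q : 'rV[R]_(n + 1)) (k a b : 'I_(n + 1)) :
  hyp_space (lsubmx q) ->
  christoffel (@lorentz_metric R n) q k a b =
  dlog1 (lsubmx q) 0 a * horiz b k + dlog1 (lsubmx q) 0 b * horiz a k
  - dlog1 (lsubmx q) 0 k * horiz a b.
Proof.
move=> hq; have c0 := lt0r_neq0 (conf_gt0 _ hq).
set c := conf (lsubmx q) in c0 *; set d := dlog1 (lsubmx q).
rewrite /christoffel invmx_lorentz //.
set I := _ - vert.
have IH b' : \sum_l I k l * horiz b' l = c^-1 * horiz b' k.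
  transitivity ((I *m horiz) k b').
    by rewrite mxE; apply: eq_bigr => l _; rewrite (horiz_tr b').
  rewrite mulmxBl vert_horiz subr0 -scalemxAl horiz_idem mxE.
  by rewrite (horiz_tr b').
have Id : \sum_l I k l * d 0 l = c^-1 * d 0 k.
  transitivity ((d *m I^T) 0 k).
    by rewrite mxE; apply: eq_bigr => l _; rewrite [I^T _ _]mxE mulrC.
  have -> : I^T = I.
    by rewrite /I linearB linearZ /= /horiz /vert !tr_block_mx !trmx1 !trmx0.
  by rewrite mulmxBr dlog1_vert subr0 -scalemxAr dlog1_horiz mxE.
rewrite (eq_bigr (fun l => 2 * c * d 0 a * (I k l * horiz b l) +
  2 * c * d 0 b * (I k l * horiz a l) - 2 * c * horiz a b * (I k l * d 0 l))); last first.
  by move=> l _; rewrite !partial_lorentz // -/c -/d; ring.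
rewrite sumrB big_split /= -!mulr_sumr !IH Id.
by field.
Qed.

End Lorentz.

(** * Reduction of the translator equation to a scalar equation *)

Section Translator.
Context {R : realType} {n : nat}.
Implicit Types (Omega : set 'rV[R]_n) (u : 'rV[R]_n -> R) (x : 'rV[R]_n).

Definition dot (a b : 'rV[R]_n) : R := \sum_i a 0 i * b 0 i.

Lemma dot_delta (p : 'rV[R]_n) k : dot (delta_mx 0 k) p = p 0 k.
Proof.
rewrite /dot; under eq_bigr => l _ do rewrite mxE eqxx /= mulrC eq_sym.
exact: sum_delta.
Qed.

Lemma dot_combination (a b f p : 'rV[R]_n) (c1 c2 c3 : R) :
  dot (c1 *: a + c2 *: b - c3 *: f) p =
  c1 * dot a p + c2 * dot b p - c3 * dot f p.
Proof.
rewrite /dot !mulr_sumr -big_split -sumrB /=; apply: eq_bigr => i _.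
by rewrite !mxE; ring.
Qed.

Definition euclid_grad u x : 'rV[R]_n := \row_i partial i u x.

Definition euclid_hess u x : 'M[R]_n := \matrix_(i, j) partial i (partial j u) x.

Definition quad (M : 'M[R]_n) (p : 'rV[R]_n) : R :=
  \sum_i \sum_j p 0 i * p 0 j * M i j.

Lemma partial_graph Omega u x i : C1_on Omega u -> Omega x ->
  partial i (graph u) x = row_mx (delta_mx 0 i) (partial i u x)%:M.
Proof.
move=> uC1 Ox; have [du _] := uC1 i x Ox.
suff [] : is_derive x (delta_mx 0 i) (graph u)
    (row_mx (delta_mx 0 i) (partial i u x)%:M) by [].
apply: is_derive_mx => j k; rewrite ord1 /graph.
case: (split_ordP k) => l ->; under eq_fun do rewrite ?row_mxEl ?row_mxEr.
  by rewrite row_mxEl; exact: is_derive_coord.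
under eq_fun do rewrite ord1 mxE eqxx mulr1n.
by rewrite row_mxEr ord1 mxE eqxx mulr1n; exact: derivableP.
Qed.

Lemma partial2_graph Omega u x i j : open Omega -> C2_on Omega u -> Omega x ->
  partial i (partial j (graph u)) x =
  row_mx 0 (partial i (partial j u) x)%:M.
Proof.
move=> Oo [uC1 uC2] Ox; have [du _] := uC2 j i x Ox.
pose tangent (y : 'rV[R]_n) : 'rV[R]_(n + 1) :=
    row_mx (delta_mx (0 : 'I_1) j) (partial j u y)%:M.
(* The formula for the first derivative is available only on [Omega], which is a neighbourhood of
   [x]. *)
transitivity (partial i tangent x).
  apply: near_eq_derive; have xO : nbhs x Omega by apply: open_nbhs_nbhs; split.
  by near=> y; apply: (partial_graph Omega) => //; near: y.
suff [] : is_derive x (delta_mx 0 i)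
    tangent (row_mx 0 (partial i (partial j u) x)%:M) by [].
apply: is_derive_mx => k l; rewrite ord1 /tangent.
case: (split_ordP l) => m ->; under eq_fun do rewrite ?row_mxEl ?row_mxEr.
  by rewrite row_mxEl [X in is_derive _ _ _ X]mxE; exact: is_derive_cst.
under eq_fun do rewrite ord1 mxE eqxx mulr1n.
by rewrite row_mxEr ord1 mxE eqxx mulr1n; exact: derivableP.
Unshelve. all: by end_near. Qed.

Lemma first_form_graph Omega u x : C1_on Omega u -> Omega x ->
  first_form (@lorentz_metric R n) (graph u) x =
  (conf x)%:M - (euclid_grad u x)^T *m euclid_grad u x.
Proof.
move=> uC1 Ox; apply/matrixP => i j.
rewrite !mxE big_ord1 !mxE /inner !(partial_graph Omega) //.
rewrite /lorentz_metric /graph row_mxKl mul_row_block !mulmx0 addr0 add0r.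
rewrite mulmxN mulmx1 tr_row_mx mul_row_col mxE /hyp_metric -/(conf x).
rewrite mul_mx_scalar -scalemxAl trmx_delta mul_delta_mx_cond.
rewrite tr_scalar_mx mulNmx -scalar_mxM !mxE !eqxx !mulr1n.
by case: (i == j); rewrite ?mulr1n ?mulr0n !mxE ?eqxx ?mulr1 ?mulr0.
Qed.

(** The three scalar pairings are parameters so that their values for coordinate tangent vectors can
    be supplied directly. *)
Lemma christoffel_contraction (q X Y : 'rV[R]_(n + 1)) (a0 b0 c0 : R) :
  hyp_space (lsubmx q) -> (dlog1 (lsubmx q) *m X^T) 0 0 = a0 ->
  (dlog1 (lsubmx q) *m Y^T) 0 0 = b0 -> (X *m horiz *m Y^T) 0 0 = c0 ->
  \row_k (\sum_a \sum_b christoffel (@lorentz_metric R n) q k a b * X 0 a * Y 0 b)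
  = a0 *: (Y *m horiz) + b0 *: (X *m horiz) - c0 *: dlog1 (lsubmx q).
Proof.
move=> hq <- <- <-; set d := dlog1 _; apply/rowP => k; rewrite [LHS]mxE.
rewrite (eq_bigr (fun a => \sum_b (d 0 a * horiz b k + d 0 b * horiz a k
    - d 0 k * horiz a b) * X 0 a * Y 0 b)); last first.
  by move=> a _; apply: eq_bigr => b _; rewrite christoffel_lorentz.
move: (@horiz R n) d => H d.
rewrite (eq_bigr (fun a => d 0 a * X 0 a * (Y *m H) 0 k +
    (d *m Y^T) 0 0 * (X 0 a * H a k) - d 0 k * (X 0 a * (H *m Y^T) a 0))); last first.
  move=> a _; rewrite !mxE.
  under [\sum_j d 0 j * _]eq_bigr => b _ do rewrite mxE.
  under [X in _ - _ * (_ * X)]eq_bigr => b _ do rewrite mxE.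
  rewrite !mulr_sumr !mulr_suml -big_split -sumrB /=.
  by apply: eq_bigr => b _; ring.
rewrite sumrB big_split /= -!mulr_suml -!mulr_sumr -mulmxA !mxE.
under [\sum_j d 0 j * X^T _ _]eq_bigr => b _ do rewrite mxE.
by rewrite [X in _ - X]mulrC.
Qed.

(** The Christoffel symbols contribute only to the horizontal part, and the second derivatives of
    the immersion only to the vertical part. *)
Lemma ambient_cov_graph Omega u x i j : Omega `<=` hyp_space -> open Omega ->
  C2_on Omega u -> Omega x ->
  ambient_cov (@lorentz_metric R n) (graph u) x i j =
  row_mx (dlog x 0 i *: delta_mx 0 j + dlog x 0 j *: delta_mx 0 i
          - (i == j)%:R *: dlog x) (partial i (partial j u) x)%:M.
Proof.
move=> Oh Oo uC2 Ox; have [uC1 _] := uC2.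
rewrite /ambient_cov (partial2_graph Omega) // !(partial_graph Omega) //.
set Ei := row_mx (delta_mx 0 i) _; set Ej := row_mx (delta_mx 0 j) _.
have graphl : lsubmx (graph u x) = x by rewrite row_mxKl.
have EH (k : 'I_n) (c : R) :
    row_mx (delta_mx 0 k) c%:M *m @horiz R n = row_mx (delta_mx 0 k) 0.
  by rewrite /horiz mul_row_block !mulmx1 !mulmx0 !addr0.
have dE (k : 'I_n) (c : R) :
    (dlog1 x *m (row_mx (delta_mx 0 k) c%:M : 'rV[R]_(n + 1))^T) 0 0 = dlog x 0 k.
  rewrite tr_row_mx mul_row_col mul0mx addr0 trmx_delta mxE.
  under eq_bigr => a _ do rewrite [delta_mx _ _ _ _]mxE eqxx andbT eq_sym.
  exact: sum_delta.
have dij : (Ei *m horiz *m Ej^T) 0 0 = (i == j)%:R.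
  rewrite EH tr_row_mx mul_row_col mul0mx addr0 trmx_delta mul_delta_mx_cond.
  by case: (i == j); rewrite !mxE ?eqxx.
have EHi : Ei *m horiz = row_mx (delta_mx 0 i) 0 := EH i _.
have EHj : Ej *m horiz = row_mx (delta_mx 0 j) 0 := EH j _.
have dEi : (dlog1 x *m Ei^T) 0 0 = dlog x 0 i := dE i _.
have dEj : (dlog1 x *m Ej^T) 0 0 = dlog x 0 j := dE j _.
clearbody Ei Ej.
rewrite (christoffel_contraction (graph u x) Ei Ej (dlog x 0 i) (dlog x 0 j)
  (i == j)%:R) ?graphl //; last exact: Oh.
rewrite EHi EHj /dlog1 !scale_row_mx opp_row_mx !add_row_mx !scaler0 oppr0.
by rewrite !addr0 add0r.
Qed.

(* The functional [V |-> V *m co_normal p] annihilates the tangent space of a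
   graph with Euclidean gradient [p]. *)
Definition co_normal (p : 'rV[R]_n) : 'cV[R]_(n + 1) := col_mx p^T (- 1%:M).

Lemma row_mx_co_normal (a p : 'rV[R]_n) (b : R) :
  (row_mx a b%:M *m co_normal p) 0 0 = dot a p - b.
Proof.
rewrite mul_row_col mulmxN mulmx1 !mxE eqxx mulr1n; congr (_ - _).
by apply: eq_bigr => i _; rewrite mxE.
Qed.

Lemma co_normal_graph Omega u x i : C1_on Omega u -> Omega x ->
  partial i (graph u) x *m co_normal (euclid_grad u x) = 0.
Proof.
move=> uC1 Ox; rewrite (partial_graph Omega) //.
apply/matrixP => a b; rewrite !ord1 row_mx_co_normal dot_delta.
by rewrite [euclid_grad _ _ _ _]mxE subrr mxE.
Qed.

(** The projection subtracts a combination of tangent vectors, all killed by the covector. Hence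
    both sides of the translator equation can be paired with it without computing any projection. *)
Lemma co_normal_normal_proj Omega u x V : C1_on Omega u -> Omega x ->
  normal_proj (@lorentz_metric R n) (graph u) x V *m co_normal (euclid_grad u x)
  = V *m co_normal (euclid_grad u x).
Proof.
move=> uC1 Ox; rewrite mulmxBl mulmx_suml big1 ?subr0 // => i _.
rewrite mulmx_suml big1 // => j _.
by rewrite -scalemxAl (co_normal_graph Omega) // scaler0.
Qed.

(** The hyperbolic gradient is the Euclidean one divided by [conf x], so its squared length is
    [sqnorm (euclid_grad u x) / conf x]. *)
Lemma space_like_sqnorm Omega u x : Omega `<=` hyp_space ->
  space_like Omega u -> Omega x -> sqnorm (euclid_grad u x) < conf x.
Proof.
move=> Oh usl Ox; have := usl x Ox.
have c0 : 0 < conf x by apply/conf_gt0/Oh.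
have gradE : grad hyp_metric u x = (conf x)^-1 *: euclid_grad u x.
  apply/rowP => i; rewrite !mxE /hyp_metric -/(conf x) invmx_scalar.
  under eq_bigr => j _ do rewrite mxE -mulr_natr mulrAC.
  exact: (sum_delta i (fun j => (conf x)^-1 * partial j u x)).
rewrite /metric_norm gradE /inner /hyp_metric -/(conf x).
rewrite mul_mx_scalar scalerA mulfV ?gt_eqF // scale1r linearZ /= -scalemxAr.
rewrite mulmx_trmx_sqnorm.
rewrite !mxE eqxx mulr1n -[X in _ < X]sqrtr1 ltr_sqrt // => h.
by rewrite mulrC ltr_pdivrMr // mul1r in h.
Qed.

(** The contraction of the second fundamental form with the inverse first form, up to the factor
    [- (conf x)^-1]. The [f] terms and the diagonal term give [- 2 * q + n * q] against the
    identity, and [(- 2 + 1) * sqnorm p * q] against the rank-one part. *)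
Lemma trace_rank1 (M : 'M[R]_n) (f p : 'rV[R]_n) (b : R) :
  let q := dot f p in
  \sum_i \sum_j ((i == j)%:R + b * (p 0 i * p 0 j)) *
    (M i j - f 0 i * p 0 j - f 0 j * p 0 i + (i == j)%:R * q) =
  \tr M + (n%:R - 2) * q + b * (quad M p - sqnorm p * q).
Proof.
move=> q; pose X i j := M i j - f 0 i * p 0 j - f 0 j * p 0 i + (i == j)%:R * q.
have trX : \sum_i \sum_j X i j * (i == j)%:R = \tr M + (n%:R - 2) * q.
  under eq_bigr => i _ do rewrite sum_delta /X eqxx mul1r.
  rewrite big_split /= !sumrB sumr_const card_ord -mulr_natl -/(mxtrace M).
  by rewrite -/(dot f p) -/q; ring.
have pXp : \sum_i \sum_j p 0 i * p 0 j * X i j = quad M p - sqnorm p * q.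
  have E i : \sum_j p 0 i * p 0 j * X i j = \sum_j p 0 i * p 0 j * M i j
      - f 0 i * p 0 i * sqnorm p - p 0 i ^+ 2 * q + p 0 i ^+ 2 * q.
    rewrite (eq_bigr (fun j => p 0 i * p 0 j * M i j - f 0 i * p 0 i * (p 0 j ^+ 2)
      - p 0 i ^+ 2 * (f 0 j * p 0 j) + p 0 i * p 0 j * q * (i == j)%:R)).
      rewrite big_split /= !sumrB -!mulr_sumr -/(sqnorm p) -/(dot f p) -/q.
      by rewrite (sum_delta i (fun j => p 0 i * p 0 j * q)) expr2.
    by move=> j _; rewrite /X; ring.
  rewrite (eq_bigr _ (fun i _ => E i)) big_split /= !sumrB -!mulr_suml.
  by rewrite -/(dot f p) -/(sqnorm p) -/q subrK mulrC.
rewrite -trX -pXp mulr_sumr -big_split /=; apply: eq_bigr => i _.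
by rewrite mulr_sumr -big_split /=; apply: eq_bigr => j _; rewrite -/(X i j); ring.
Qed.

(** The translator equation in coordinates, cleared of its denominators [conf x] and
    [conf x - sqnorm p]. Its coefficient matrix in [M] is [(conf x - sqnorm p)%:M + p^T *m p],
    positive definite where the graph is space-like. *)
Definition translator_op x (p : 'rV[R]_n) (M : 'M[R]_n) : R :=
  (conf x - sqnorm p) * (\tr M + (n%:R - 2) * dot (dlog x) p) + quad M p
  - sqnorm p * dot (dlog x) p - conf x * (conf x - sqnorm p).

Lemma translator_op_eq0 Omega u x : Omega `<=` hyp_space -> open Omega ->
  C2_on Omega u -> space_like Omega u -> translator Omega u -> Omega x ->
  translator_op x (euclid_grad u x) (euclid_hess u x) = 0.
Proof.
move=> Oh Oo uC2 usl utr Ox; have [uC1 _] := uC2; rewrite /translator_op.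
pose p := euclid_grad u x; pose M := euclid_hess u x; rewrite -/p -/M.
pose D := conf x - sqnorm p; rewrite -/D; apply/eqP; rewrite subr_eq0; apply/eqP.
have c0 : 0 < conf x by apply/conf_gt0/Oh.
have D0 : 0 < D by rewrite subr_gt0; exact: (space_like_sqnorm Omega).
have := utr x Ox => /(congr1 (fun V => (V *m co_normal p) 0 0)).
rewrite (co_normal_normal_proj Omega) // /d_t mul_row_col mul0mx add0r mul1mx.
rewrite /mean_curvature_vector mulmx_suml summxE.
rewrite (first_form_graph Omega) // invmx_rank1_perturbation ?gt_eqF // -/p -/D.
set f := dlog x; set q := dot f p.
(* The covector takes the vertical component with a minus sign, hence the factor [- (conf x)^-1]. It
   likewise sends [d_t] to -1, so the signs cancel on multiplying by [- conf x]. *)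
have summand i j : (((conf x)^-1 *: (1%:M + D^-1 *: (p^T *m p))) i j *:
    second_form (@lorentz_metric R n) (graph u) x i j *m co_normal p) 0 0 =
    - (conf x)^-1 * (((i == j)%:R + D^-1 * (p 0 i * p 0 j)) *
      (M i j - f 0 i * p 0 j - f 0 j * p 0 i + (i == j)%:R * q)).
  rewrite -scalemxAl [LHS]mxE (co_normal_normal_proj Omega) //.
  rewrite (ambient_cov_graph Omega) // row_mx_co_normal dot_combination !dot_delta.
  rewrite -/f -/q -/p !mxE big_ord1 !mxE.
  by ring.
rewrite (eq_bigr (fun i => - (conf x)^-1 * \sum_j (((i == j)%:R + D^-1 * (p 0 i * p 0 j)) *
      (M i j - f 0 i * p 0 j - f 0 j * p 0 i + (i == j)%:R * q)))); last first.
  by move=> i _; rewrite mulmx_suml summxE mulr_sumr; apply: eq_bigr => j _; exact: summand.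
rewrite -mulr_sumr trace_rank1 !mxE eqxx mulr1n -/q => H.
have {}H : \tr M + (n%:R - 2) * q + D^-1 * (quad M p - sqnorm p * q) = conf x.
  have := congr1 ( *%R (- conf x)) H.
  by rewrite mulrA mulrNN mulfV ?gt_eqF // mul1r mulrN1 opprK.
rewrite -[X in _ = X * D]H; by field; rewrite gt_eqF.
Qed.

End Translator.

(** * Gradient shifts and ellipticity of the scalar operator *)

Section Operator.
Context {R : realType} {n : nat}.
Implicit Types (x p q w : 'rV[R]_n) (M N : 'M[R]_n) (k : 'I_n).

Lemma quad_delta M i : quad M (delta_mx 0 i) = M i i.
Proof.
rewrite /quad (bigD1 i) //= (bigD1 i) //= !mxE !eqxx !mul1r.
rewrite big1 ?addr0 => [|j ji]; last by rewrite !mxE (negPf ji) mulr0 mul0r.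
rewrite big1 ?addr0 // => j ji.
by rewrite big1 // => l _; rewrite !mxE (negPf ji) !mul0r.
Qed.

Lemma dot_sub_delta (a q : 'rV[R]_n) k (s : R) :
  dot a (q - s *: delta_mx 0 k) = dot a q - s * a 0 k.
Proof.
rewrite /dot -(sum_delta k (fun i => a 0 i)) mulr_sumr -sumrB.
by apply: eq_bigr => i _; rewrite !mxE eqxx eq_sym /=; ring.
Qed.

Lemma sqnorm_sub_delta q k (s : R) :
  sqnorm (q - s *: delta_mx 0 k) = sqnorm q - 2 * s * q 0 k + s ^+ 2.
Proof.
rewrite /sqnorm (bigD1 k) //= [in RHS](bigD1 k) //= !mxE !eqxx /=.
rewrite (eq_bigr (fun i => q 0 i ^+ 2)); last first.
  by move=> i ik; rewrite !mxE (negPf ik) andbF mulr0 subr0.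
ring.
Qed.

Lemma quad_sub_delta N q k (s : R) :
  quad N (q - s *: delta_mx 0 k) =
  quad N q - s * (\sum_j (N k j + N j k) * q 0 j) + s ^+ 2 * N k k.
Proof.
pose e i : R := (k == i)%:R.
have qe i : (q - s *: delta_mx 0 k) 0 i = q 0 i - s * e i.
  by rewrite !mxE eqxx eq_sym.
have H (F : 'I_n -> R) : \sum_i F i * e i = F k by exact: sum_delta.
have inner i : \sum_j (q 0 i - s * e i) * (q 0 j - s * e j) * N i j =
    \sum_j q 0 i * q 0 j * N i j - s * (N i k * q 0 i)
    - s * ((\sum_j N i j * q 0 j) * e i) + s ^+ 2 * (N i k * e i).
  have -> : N i k * q 0 i = \sum_j N i j * q 0 i * e j.
    by rewrite (H (fun j => N i j * q 0 i)).
  have -> : N i k * e i = \sum_j N i j * e i * e j.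
    by rewrite (H (fun j => N i j * e i)).
  rewrite !mulr_suml !mulr_sumr -!sumrB -big_split /=.
  by apply: eq_bigr => j _; ring.
rewrite /quad; under eq_bigr => i _ do under eq_bigr => j _ do rewrite !qe.
rewrite (eq_bigr _ (fun i _ => inner i)) big_split /= !sumrB -!mulr_sumr !H.
have -> : \sum_j (N k j + N j k) * q 0 j =
    \sum_j N k j * q 0 j + \sum_j N j k * q 0 j.
  by rewrite -big_split; apply: eq_bigr => j _; rewrite mulrDl.
by ring.
Qed.

(** The difference quotient of [translator_op] in its gradient argument along the [k]-th axis, with
    the division by [s] carried out; being polynomial in [s], it stays bounded as [s] tends to 0.
    The factor [a] satisfies [sqnorm q - sqnorm (q - s *: delta_mx 0 k) = s * a]. Both [N k j] and
    [N j k] occur because [N] is a general square matrix. *)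
Definition translator_rem x q N k (s : R) : R :=
  let a := 2 * q 0 k - s in
  let d := dot (dlog x) q in
  a * (\tr N + (n%:R - 2) * d)
  - (conf x - sqnorm q + s * a) * ((n%:R - 2) * dlog x 0 k)
  - (\sum_j (N k j + N j k) * q 0 j) + s * N k k
  + sqnorm q * dlog x 0 k + a * (d - s * dlog x 0 k) - conf x * a.

Lemma translator_op_sub_delta x q N k s :
  translator_op x (q - s *: delta_mx 0 k) N =
  translator_op x q N + s * translator_rem x q N k s.
Proof.
rewrite /translator_op quad_sub_delta sqnorm_sub_delta dot_sub_delta.
by rewrite /translator_rem; ring.
Qed.

(** Testing the inequality of quadratic forms on basis vectors bounds the trace and yields the gain
    [c]; testing it on [p] bounds the remaining second-order term. *)
Lemma translator_op_monotone x p M N k (c : R) : sqnorm p <= conf x ->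
  0 <= c -> (forall w, quad M w <= quad N w - c * w 0 k ^+ 2) ->
  translator_op x p M <= translator_op x p N - c * (conf x - sqnorm p).
Proof.
move=> px c0 MN.
have trMN : \tr M <= \tr N - c.
  rewrite /mxtrace -[c in _ - c](sum_delta k (fun=> c)) -sumrB.
  apply: ler_sum => i _; have := MN (delta_mx 0 i).
  by rewrite !quad_delta mxE eqxx /=; case: (k == i); rewrite /= ?expr1n ?expr0n.
rewrite /translator_op; have := MN p; have := sqr_ge0 (p 0 k).
nra.
Qed.

End Operator.

(** * Boundedness and continuity on compact sets *)

Section Bounded.
Context {T : Type} {R : realType} (A : set T).

Definition bounded_on (f : T -> R) := exists B, forall z, A z -> `|f z| <= B.

Lemma bounded_on_cst c : bounded_on (fun=> c).
Proof. by exists `|c|. Qed.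

Lemma bounded_onD f g : bounded_on f -> bounded_on g ->
  bounded_on (fun z => f z + g z).
Proof.
move=> [B Bf] [C Cg]; exists (B + C) => z Az.
by apply: le_trans (ler_normD _ _) _; apply: lerD; [exact: Bf|exact: Cg].
Qed.

Lemma bounded_onN f : bounded_on f -> bounded_on (fun z => - f z).
Proof. by move=> [B Bf]; exists B => z Az; rewrite normrN; exact: Bf. Qed.

Lemma bounded_onM f g : bounded_on f -> bounded_on g ->
  bounded_on (fun z => f z * g z).
Proof.
move=> [B Bf] [C Cg]; exists (B * C) => z Az.
by rewrite normrM; apply: ler_pM => //; [exact: Bf|exact: Cg].
Qed.

Lemma bounded_on_sum n (f : 'I_n -> T -> R) : (forall i, bounded_on (f i)) ->
  bounded_on (fun z => \sum_i f i z).
Proof.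
move=> /(_ _)/cid fb; exists (\sum_i sval (fb i)) => z Az.
apply: le_trans (ler_norm_sum _ _ _) _; apply: ler_sum => i _.
exact: (svalP (fb i)).
Qed.

End Bounded.

Section Continuity.
Context {R : realType}.

Lemma continuous_at_sum {T : topologicalType} {n : nat} (f : 'I_n -> T -> R) x :
  (forall i, {for x, continuous (f i)}) ->
  {for x, continuous (fun y => \sum_i f i y)}.
Proof.
move=> fc; have -> : (fun y => \sum_i f i y) = \sum_i f i.
  by apply/funext => y; rewrite fct_sumE.
elim/big_ind : _ => [|g h gc hc|i _]; [exact: cst_continuous| |exact: fc].
exact: continuousD.
Qed.

Lemma continuous_at_sqr {T : topologicalType} (f : T -> R) x :
  {for x, continuous f} -> {for x, continuous (fun y => f y ^+ 2)}.
Proof. by move=> fc; apply: (continuousM fc fc). Qed.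

Lemma continuous_sqnorm {n : nat} : continuous (@sqnorm R n).
Proof.
by move=> x; apply: continuous_at_sum => i; apply/continuous_at_sqr/coord_continuous.
Qed.

Lemma continuous_conf {n : nat} (x : 'rV[R]_n) : hyp_space x ->
  {for x, continuous (@conf R n)}.
Proof.
rewrite /hyp_space /= => hx; apply: continuousM; first exact: cst_continuous.
apply: continuousV; first by rewrite expf_eq0 /= subr_eq0 gt_eqF.
apply: continuous_at_sqr; apply: continuousB; first exact: cst_continuous.
exact: continuous_sqnorm.
Qed.

Lemma compact_bounded_on {T : topologicalType} (K : set T) (f : T -> R) :
  compact K -> (forall x, K x -> {for x, continuous f}) -> bounded_on K f.
Proof.
move=> cK fc; have [K0|/set0P K0] := eqVneq K set0.
  by exists 0 => z; rewrite K0.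
have fK : {within K, continuous (fun z => `|f z|)}.
  apply: continuous_in_subspaceT => x; rewrite inE => Kx.
  by apply: continuous_comp; [exact: fc|exact: norm_continuous].
have [c _ cmax] := compact_EVT_max K0 cK fK.
by exists `|f c| => z Kz; apply: cmax; rewrite inE.
Qed.

End Continuity.

(** * Compactness of the closure of a bounded domain *)

Section Closure.
Context {R : realType} {n : nat}.
Implicit Types (Omega : set 'rV[R]_n) (x y : 'rV[R]_n).

Lemma sqnorm_ge0 x : 0 <= sqnorm x.
Proof. by apply: sumr_ge0 => i _; rewrite sqr_ge0. Qed.

Lemma sqnorm_eq0 x : sqnorm x <= 0 -> x = 0.
Proof.
move=> x0; apply/rowP => i; rewrite mxE.
have : sqnorm x == 0 by rewrite eq_le x0 sqnorm_ge0.
rewrite /sqnorm psumr_eq0 => [/allP /(_ i)|j _]; last exact: sqr_ge0.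
by rewrite mem_index_enum sqrf_eq0 => /(_ isT)/eqP.
Qed.

Lemma normr_coord_le1 x i : sqnorm x <= 1 -> `|x 0 i| <= 1.
Proof.
move=> x1; have : x 0 i ^+ 2 <= 1.
  apply: le_trans x1; rewrite /sqnorm (bigD1 i) //= lerDl.
  by apply: sumr_ge0 => j _; rewrite sqr_ge0.
by rewrite -[x 0 i ^+ 2]real_normK ?num_real // expr_le1.
Qed.

(* A bound on [hyp_dist x0] on [Omega] gives [|x0 - y|^2 <= K (1 - |y|^2)] there,
   hence on the closure, where [|y| = 1] would force [y = x0]. *)
Lemma closure_hyp_bounded_domain Omega : hyp_bounded_domain Omega ->
  closure Omega `<=` hyp_space.
Proof.
move=> [Oh [x0 Ox0] _ _ [C OC]].
have x01 : sqnorm x0 < 1 by exact: Oh.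
(* The argument [z] of [arcosh] satisfies [z <= expR (arcosh z) <= expR C]; clearing the denominator
   of [z - 1] gives this constant. *)
pose K := (expR C - 1) * (1 - sqnorm x0).
pose F := [set y | 2 * sqnorm (x0 - y) - K * (1 - sqnorm y) <= 0]
  `&` [set y : 'rV[R]_n | sqnorm y <= 1].
have cF : closed F.
  apply: closedI.
    apply: (@preimage_closed _ _ (fun y => 2 * sqnorm (x0 - y) - K * (1 - sqnorm y))
      [set z | z <= 0]); last exact: closed_le.
    have distc y : {for y, continuous (fun y => sqnorm (x0 - y))}.
      apply: (continuous_comp _ (continuous_sqnorm _)).
      by apply: continuousB; first exact: cst_continuous.
    have Fc y : {for y, continuous (fun y => 2 * sqnorm (x0 - y) - K * (1 - sqnorm y))}.
      apply: continuousB; apply: continuousM => //; try exact: cst_continuous.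
      by apply: continuousB; [exact: cst_continuous|exact: continuous_sqnorm].
    by move=> y _; exact: Fc.
  apply: (@preimage_closed _ _ (@sqnorm R n) [set z | z <= 1]); last exact: closed_le.
  by move=> y _; exact: continuous_sqnorm.
have OF : Omega `<=` F.
  move=> y Oy; have y1 : sqnorm y < 1 by exact: Oh.
  split; last exact: ltW.
  have := OC x0 y Ox0 Oy; rewrite /hyp_dist /arcosh.
  set P := (1 - sqnorm x0) * (1 - sqnorm y).
  have P0 : 0 < P by rewrite mulr_gt0 // subr_gt0.
  set z := 1 + _.
  have z1 : 1 <= z.
    rewrite /z lerDl; apply: divr_ge0; last exact: ltW.
    by apply: mulr_ge0 => //; exact: sqnorm_ge0.
  have zs : 0 < z + Num.sqrt (z ^+ 2 - 1).
    by rewrite ltr_wpDr ?sqrtr_ge0 //; lra.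
  move=> lnz; have zC : z <= expR C.
    apply: (@le_trans _ _ (z + Num.sqrt (z ^+ 2 - 1))).
      by rewrite lerDl sqrtr_ge0.
    by rewrite -[X in X <= _]lnK ?posrE // ler_expR.
  have : z - 1 <= expR C - 1 by rewrite lerD2r.
  rewrite /z addrC addKr ler_pdivrMr // => H.
  by rewrite /= subr_le0 /K -mulrA.
move=> y /(closure_subset OF); rewrite -(closure_id _).1 // => -[/= yK y1].
rewrite /hyp_space /= lt_neqAle y1 andbT; apply/eqP => ye.
have /sqnorm_eq0/eqP : sqnorm (x0 - y) <= 0.
  by move: yK; rewrite ye subrr mulr0 subr0; lra.
by rewrite subr_eq0 => /eqP x0y; move: x01; rewrite x0y ye ltxx.
Qed.

Lemma compact_closure_hyp_bounded_domain Omega : hyp_bounded_domain Omega ->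
  compact (closure Omega).
Proof.
move=> /closure_hyp_bounded_domain Oh; apply: bounded_closed_compact;
  last exact: closed_closure.
exists 1; split => // M M1 y /Oh /= y1; apply: ltW; apply: le_lt_trans M1.
by apply: ler_norm_rV => // i; exact: normr_coord_le1 (ltW y1).
Qed.

End Closure.

(** * First and second order conditions at a perturbed maximum *)

Section MaximumPrinciple.
Context {R : realType} {n : nat}.
Implicit Types (Omega : set 'rV[R]_n) (u v : 'rV[R]_n -> R) (x w : 'rV[R]_n).

Definition perturbation (k : 'I_n) (eps a : R) x : R := eps * expR (a * x 0 k).

(** The free factor [c] allows two uses: on the perturbation along a line, and on its first
    derivative. *)
Lemma is_derive_exp_line (c a b t : R) :
  is_derive t 1 (fun s : R => c * expR (a + s * b)) (c * b * expR (a + t * b)).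
Proof.
have dl : is_derive t 1 (fun s : R => a + s * b) b.
  have -> : (fun s : R => a + s * b) = cst a + b *: id.
    by apply/funext => s /=; rewrite mulrC.
  have := is_deriveD (is_derive_cst a t 1) (is_deriveZ b (is_derive_id t 1)).
  by rewrite add0r [_ *: _]mulr1.
have de := @is_derive1_comp R expR (fun s : R => a + s * b) t _ _
  (is_derive_expR (a + t * b)) dl.
have -> : c * b * expR (a + t * b) = c *: (expR (a + t * b) * b).
  by rewrite -mulrA (mulrC b).
have dZ := is_deriveZ c de; exact dZ.
Qed.

Lemma second_derivative_line u Omega x w : open Omega -> C2_on Omega u -> Omega x ->
  is_derive (0 : R) 1 (fun s => \sum_i w 0 i * partial i u (x + s *: w))
   (quad (euclid_hess u x) w).
Proof.
move=> Oo [_ uC2] Ox.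
have -> : (fun s => \sum_i w 0 i * partial i u (x + s *: w)) =
    \sum_i (w 0 i *: (fun s : R => partial i u (x + s *: w))).
  by apply/funext => s; rewrite fct_sumE.
rewrite (_ : quad _ _ = \sum_i w 0 i *: (\sum_j w 0 j * partial j (partial i u) x)).
  apply: is_derive_sum => i; apply: is_deriveZ.
  rewrite -{2}[x]addr0 -(scale0r w).
  by apply: (C1_on_is_derive_line Omega) => //; rewrite scale0r addr0.
rewrite /quad exchange_big /=; apply: eq_bigr => i _.
rewrite [RHS]mulr_sumr; apply: eq_bigr => j _.
by rewrite [euclid_hess _ _ _ _]mxE [RHS]mulrA (mulrC (w 0 j)).
Qed.

(** The second derivative test is applied on every line through [x]. First derivatives along the
    coordinate axes give the gradient identity. The exponential contributes [s * w 0 k] to the first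
    derivative and [a * s * w 0 k ^+ 2] to the second: the extra factor [a] is what makes the
    second-order gain dominate. *)
Lemma local_max_perturbed u v Omega x k (eps a : R) : open Omega ->
  C2_on Omega u -> C2_on Omega v -> Omega x ->
  (forall y, Omega y -> u y - v y + perturbation k eps a y <=
    u x - v x + perturbation k eps a x) ->
  let s := a * perturbation k eps a x in
  euclid_grad u x = euclid_grad v x - s *: delta_mx 0 k /\
  forall w, quad (euclid_hess u x) w <=
    quad (euclid_hess v x) w - a * s * w 0 k ^+ 2.
Proof.
move=> Oo uC2 vC2 Ox xmax s.
have test w : \sum_i w 0 i * partial i u x - \sum_i w 0 i * partial i v x +
      s * w 0 k = 0 /\
    quad (euclid_hess u x) w - quad (euclid_hess v x) w + a * s * w 0 k ^+ 2 <= 0.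
  pose g t := u (x + t *: w) - v (x + t *: w) +
    eps * expR (a * x 0 k + t * (a * w 0 k)).
  pose dg t := \sum_i w 0 i * partial i u (x + t *: w)
    - \sum_i w 0 i * partial i v (x + t *: w)
    + eps * (a * w 0 k) * expR (a * x 0 k + t * (a * w 0 k)).
  have lineO : \forall t \near (0 : R), Omega (x + t *: w).
    have cl : x + t *: w @[t --> (0 : R)] --> x.
      rewrite -{2}[x]addr0 -(scale0r w); apply: (@cvgD _ _ _ (nbhs (0 : R))).
        exact: cvg_cst.
      by apply: cvgZr_tmp; exact: cvg_id.
    by apply: cl; apply: open_nbhs_nbhs; split.
  have gE t : g t = u (x + t *: w) - v (x + t *: w) + perturbation k eps a (x + t *: w).
    by rewrite /g /perturbation !mxE mulrDr mulrCA.
  have gd : \forall t \near (0 : R), is_derive (t : R) 1 g (dg t).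
    near=> t; have Ot : Omega (x + t *: w) by near: t.
    apply: is_deriveD; last exact: is_derive_exp_line.
    apply: is_deriveB; [apply: (C1_on_is_derive_line Omega) => //; exact: uC2.1|
                        apply: (C1_on_is_derive_line Omega) => //; exact: vC2.1].
  have dgd : is_derive (0 : R) 1 dg (quad (euclid_hess u x) w
      - quad (euclid_hess v x) w +
      eps * (a * w 0 k) * (a * w 0 k) * expR (a * x 0 k + 0 * (a * w 0 k))).
    apply: is_deriveD; last exact: is_derive_exp_line.
    by apply: is_deriveB; apply: (second_derivative_line _ Omega).
  have gmax : \forall t \near (0 : R), g t <= g 0.
    near=> t; have Ot : Omega (x + t *: w) by near: t.
    by rewrite !gE scale0r addr0; exact: xmax.
  have [] := second_derivative_test _ _ _ _ gd dgd gmax.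
  rewrite /dg scale0r addr0 mul0r addr0 => d0 d2.
  have e1 : eps * (a * w 0 k) * expR (a * x 0 k) = s * w 0 k.
    by rewrite /s /perturbation; ring.
  have e2 : eps * (a * w 0 k) * (a * w 0 k) * expR (a * x 0 k) = a * s * w 0 k ^+ 2.
    by rewrite /s /perturbation; ring.
  split.
    by rewrite -[RHS]d0 e1.
  by rewrite -e2.
split=> [|w]; last first.
  by have [_ H] := test w; rewrite lerBrDr -subr_le0 addrAC.
have E (f : 'rV[R]_n -> R) i :
    \sum_j (delta_mx 0 i : 'rV[R]_n) 0 j * partial j f x = partial i f x.
  rewrite -[RHS](sum_delta i (fun j => partial j f x)).
  by apply: eq_bigr => j _; rewrite mxE eqxx mulrC eq_sym.
apply/rowP => i; have [] := test (delta_mx 0 i); rewrite !E => H _.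
have subE (A : 'rV[R]_n) (c : R) :
    (A - c *: delta_mx 0 k) 0 i = A 0 i - c * (i == k)%:R.
  by rewrite !mxE eqxx.
rewrite subE [LHS]mxE [euclid_grad v x 0 i]mxE.
have dk : (delta_mx 0 i : 'rV[R]_n) 0 k = (i == k)%:R by rewrite mxE eqxx eq_sym.
by rewrite dk in H; apply/eqP; rewrite -subr_eq0 opprB addrA addrAC H.
Unshelve. all: by end_near. Qed.

End MaximumPrinciple.

(** * Uniform bounds on compact subsets and comparison of two translators *)

Section Comparison.
Context {R : realType} {n : nat}.
Implicit Types (Omega K : set 'rV[R]_n) (u v : 'rV[R]_n -> R).

Lemma continuous_dlog (x : 'rV[R]_n) i : hyp_space x ->
  {for x, continuous (fun y => dlog y 0 i)}.
Proof.
rewrite /hyp_space /= => hx.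
have -> : (fun y : 'rV[R]_n => dlog y 0 i) = (fun y => 2 / (1 - sqnorm y) * y 0 i).
  by apply/funext => y; rewrite mxE.
apply: continuousM; last exact: coord_continuous.
apply: continuousM; first exact: cst_continuous.
apply: continuousV; first by rewrite subr_eq0 gt_eqF.
by apply: continuousB; [exact: cst_continuous|exact: continuous_sqnorm].
Qed.

Lemma euclid_gradE u i : (fun x => euclid_grad u x 0 i) = partial i u.
Proof. by apply/funext => x; rewrite mxE. Qed.

Lemma euclid_hessE u i j : (fun x => euclid_hess u x i j) = partial i (partial j u).
Proof. by apply/funext => x; rewrite mxE. Qed.

Lemma bounded_translator_rem Omega K v k : Omega `<=` hyp_space -> C2_on Omega v ->
  compact K -> K `<=` Omega ->
  exists B, forall x s, K x -> 0 <= s -> s <= 1 ->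
    translator_rem x (euclid_grad v x) (euclid_hess v x) k s <= B.
Proof.
move=> Oh [vC1 vC2] cK KO.
(* Working on pairs of a point of [K] and a value of [s] makes the bound uniform in [s]. *)
pose A := [set z : 'rV[R]_n * R | K z.1 /\ 0 <= z.2 <= 1].
have bK (f : 'rV[R]_n -> R) : (forall x, Omega x -> {for x, continuous f}) ->
    bounded_on A (fun z => f z.1).
  move=> fc; have [B BP] := compact_bounded_on _ _ cK (fun x Kx => fc x (KO x Kx)).
  by exists B => z [Kz _]; exact: BP.
have bs : bounded_on A snd.
  by exists 1 => z [_ /andP[z0 z1]]; rewrite ger0_norm.
have bp i : bounded_on A (fun z => euclid_grad v z.1 0 i).
  apply: (bK (fun x => euclid_grad v x 0 i)) => x Ox; rewrite euclid_gradE.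
  by have [_] := vC1 i x Ox.
have bN i j : bounded_on A (fun z => euclid_hess v z.1 i j).
  apply: (bK (fun x => euclid_hess v x i j)) => x Ox; rewrite euclid_hessE.
  by have [_] := vC2 j i x Ox.
have bd i : bounded_on A (fun z => dlog z.1 0 i).
  by apply: (bK (fun x => dlog x 0 i)) => x Ox; apply/continuous_dlog/Oh.
have bconf : bounded_on A (fun z => conf z.1).
  by apply: bK => x Ox; apply/continuous_conf/Oh.
have bdot : bounded_on A (fun z => dot (dlog z.1) (euclid_grad v z.1)).
  by apply: bounded_on_sum => i; exact: bounded_onM.
have bsq : bounded_on A (fun z => sqnorm (euclid_grad v z.1)).
  by apply: bounded_on_sum => i; exact: (bounded_onM _ _ _ (bp i) (bp i)).
have btr : bounded_on A (fun z => \tr (euclid_hess v z.1)).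
  exact: bounded_on_sum.
have bL : bounded_on A (fun z => \sum_j
    (euclid_hess v z.1 k j + euclid_hess v z.1 j k) * euclid_grad v z.1 0 j).
  by apply: bounded_on_sum => j; apply: bounded_onM => //; exact: bounded_onD.
have [B BP] : bounded_on A (fun z =>
    translator_rem z.1 (euclid_grad v z.1) (euclid_hess v z.1) k z.2).
  (* The remainder is a polynomial in the quantities bounded above, so its boundedness follows by
     recursion on the expression. *)
  rewrite /translator_rem.
  by repeat first [assumption | exact: bounded_on_cst | apply: bounded_onD
    | apply: bounded_onN | apply: bounded_onM].
exists B => x s Kx s0 s1; apply: le_trans (ler_norm _) (BP (x, s) _).
by split=> //=; rewrite s0.
Qed.

(** The constant is the minimum over [K] of a continuous positive function; it serves as the uniform
    ellipticity constant. *)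
Lemma space_like_bounded_away Omega K u : Omega `<=` hyp_space ->
  C1_on Omega u -> space_like Omega u -> compact K -> K `<=` Omega ->
  exists2 c, 0 < c & forall x, K x -> c <= conf x - sqnorm (euclid_grad u x).
Proof.
move=> Oh uC1 usl cK KO.
have [K0|/set0P K0] := eqVneq K set0; first by exists 1 => // x; rewrite K0.
have Dc : {within K, continuous (fun x => conf x - sqnorm (euclid_grad u x))}.
  apply: continuous_in_subspaceT => x; rewrite inE => /KO Ox.
  apply: continuousB; first exact/continuous_conf/Oh.
  apply: continuous_at_sum => i; apply: continuous_at_sqr.
  by rewrite euclid_gradE; have [_] := uC1 i x Ox.
have [c] := compact_EVT_min K0 cK Dc; rewrite inE => Kc cmin.
exists (conf c - sqnorm (euclid_grad u c)) => [|x Kx]; last by apply: cmin; rewrite inE.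
by rewrite subr_gt0; apply: (space_like_sqnorm Omega) => //; exact: KO.
Qed.

Lemma continuous_perturbation (k : 'I_n) (eps a : R) :
  continuous (perturbation k eps a : 'rV[R]_n -> R).
Proof.
move=> x; have inner : {for x, continuous (fun y : 'rV[R]_n => a * y 0 k)}.
  by apply: continuousM; [exact: cst_continuous|exact: coord_continuous].
have outer := continuous_comp inner (@continuous_expR R (a * x 0 k)).
have scale : {for x, continuous (fun=> eps)} by exact: cst_continuous.
exact: continuousM scale outer.
Qed.

Lemma translator_le Omega u v (k : 'I_n) : hyp_bounded_domain Omega ->
  {within hyp_closure Omega, continuous u} ->
  {within hyp_closure Omega, continuous v} ->
  C2_on Omega u -> C2_on Omega v ->
  space_like Omega u -> space_like Omega v ->
  translator Omega u -> translator Omega v ->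
  (forall x, hyp_boundary Omega x -> u x = v x) ->
  forall x, Omega x -> u x <= v x.
Proof.
move=> hO uC0 vC0 uC2 vC2 usl vsl utr vtr uv x1 Ox1.
have [Oh _ Oo _ _] := hO.
have clh := closure_hyp_bounded_domain _ hO.
have cclO := compact_closure_hyp_bounded_domain _ hO.
(* The Euclidean closure stays inside the ball, so the closure in hyperbolic space is the compact
   Euclidean one. *)
have hclE : hyp_closure Omega = closure Omega by exact: setIidl.
rewrite hclE in uC0 vC0.
rewrite leNgt; apply/negP => vu.
pose m := u x1 - v x1.
have m0 : 0 < m by rewrite subr_gt0.
have wc : {within closure Omega, continuous (fun y => u y - v y)}.
  by move=> y; apply: cvgB; [exact: uC0|exact: vC0].
pose K := [set y | m / 2 <= u y - v y] `&` closure Omega.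
(* A point of the closure outside [Omega] is a boundary point, where [u - v] vanishes and so is
   below [m / 2]. *)
have KO : K `<=` Omega.
  move=> y [/= wy cy]; apply: contrapT => nOy.
  have /uv uvy : hyp_boundary Omega y.
    by split; [rewrite hclE|move=> /interior_subset].
  by move: wy; rewrite uvy subrr; lra.
have cK : compact K.
  apply: (subclosed_compact _ cclO); last by move=> y [].
  have /continuous_closedP/(_ _ (@closed_ge R (m / 2)))/closed_subspaceP := wc.
  by move=> [V cV VE]; rewrite /K -VE; apply: closedI => //; exact: closed_closure.
have [c c0 cP] := space_like_bounded_away _ _ _ Oh uC2.1 usl cK KO.
have [B BP] := bounded_translator_rem _ _ _ k Oh vC2 cK KO.
(* Chosen so that [a * c = |B| + 1] exceeds [B]; neither [B] nor [c] depends on [a]. *)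
pose a := (`|B| + 1) / c.
have a0 : 0 < a by rewrite divr_gt0 // ltr_wpDl.
pose E := expR a.
have E0 : 0 < E by exact: expR_gt0.
(* Coordinates in the ball are at most 1, so the perturbation is at most [eps * E] on the closure.
   The first bound keeps it below [m / 2], which places the maximum in [K]; the second gives
   [s <= 1], the range on which [B] is valid. *)
pose eps := Num.min (m / 2 / E) (1 / (a * E)).
have eps0 : 0 < eps.
  by rewrite lt_min; apply/andP; split;
    [exact: divr_gt0 (divr_gt0 m0 _) E0|exact: divr_gt0 _ (mulr_gt0 a0 E0)].
have epsm : eps * E <= m / 2 by rewrite -ler_pdivlMr // ge_min lexx.
have epsa : a * (eps * E) <= 1.
  have : eps <= 1 / (a * E) by rewrite ge_min lexx orbT.
  rewrite ler_pdivlMr; last exact: mulr_gt0.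
  by rewrite mulrCA.
have pert_gt0 y : 0 < perturbation k eps a y.
  by apply: mulr_gt0 => //; exact: expR_gt0.
have pert_le y : closure Omega y -> perturbation k eps a y <= eps * E.
  move=> /clh /ltW /(normr_coord_le1 _ k) yk.
  rewrite ler_pM2l // ler_expR -[leRHS]mulr1 ler_pM2l //.
  exact: le_trans (ler_norm _) yk.
have hc : {within closure Omega, continuous
    (fun y => u y - v y + perturbation k eps a y)}.
  move=> y; apply: cvgD; first exact: wc.
  by apply: continuous_subspaceT; exact: continuous_perturbation.
have [|x] := compact_EVT_max _ cclO hc.
  by exists x1; exact: subset_closure.
rewrite inE => clx xmax.
have hmax y : Omega y -> u y - v y + perturbation k eps a y <=
    u x - v x + perturbation k eps a x.
  by move=> Oy; apply: xmax; rewrite inE; exact: subset_closure.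
(* Comparison with [x1] gives [u x - v x >= m - eps * E >= m / 2], since the perturbation is
   positive at [x1]. *)
have Kx : K x.
  split=> //=; have := hmax x1 Ox1; have := pert_gt0 x1; have := pert_le x clx.
  by rewrite -/m; lra.
have Ox := KO x Kx.
have [gE HE] := local_max_perturbed u v Omega x k eps a Oo uC2 vC2 Ox hmax.
set s := a * perturbation k eps a x in gE HE.
have s0 : 0 < s by rewrite mulr_gt0.
have s1 : s <= 1.
  by apply: le_trans epsa; rewrite ler_pM2l //; exact: pert_le.
have usq : sqnorm (euclid_grad u x) <= conf x.
  by apply/ltW/(space_like_sqnorm Omega).
have as0 : 0 <= a * s by rewrite mulr_ge0 // ltW.
have opu := translator_op_eq0 Omega u x Oh Oo uC2 usl utr Ox.
have opv : translator_op x (euclid_grad u x) (euclid_hess v x) =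
    s * translator_rem x (euclid_grad v x) (euclid_hess v x) k s.
  rewrite gE translator_op_sub_delta -[RHS]add0r; congr (_ + _).
  exact: (translator_op_eq0 Omega).
(* Ellipticity and the two equations combine to [0 <= s * T - a * s * D], where [T] is the remainder
   and [D = conf x - sqnorm (euclid_grad u x)]. Dividing by [s] contradicts
   [T <= B < a * c <= a * D]. *)
have substitute (A B0 C D : R) : A <= B0 - C -> A = 0 -> B0 = D -> 0 <= D - C.
  by move=> ABC A0 BD; rewrite -A0 -BD.
have := substitute _ _ _ _ (translator_op_monotone _ _ _ _ k _ usq as0 HE) opu opv.
have := BP x s Kx (ltW s0) s1.
move: (translator_rem x (euclid_grad v x) (euclid_hess v x) k s) => T TB.
have -> : s * T - a * s * (conf x - sqnorm (euclid_grad u x)) =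
    s * (T - a * (conf x - sqnorm (euclid_grad u x))).
  by rewrite [RHS]mulrBr [s * (a * _)]mulrCA [a * (s * _)]mulrA.
rewrite pmulr_rge0 // subr_ge0 leNgt => /negP; apply.
apply: (le_lt_trans TB); apply: (@lt_le_trans _ _ (a * c)).
  by rewrite divfK ?gt_eqF // ltr_pwDr // ler_norm.
by rewrite ler_pM2l //; exact: cP.
Qed.

End Comparison.

Theorem theorem5p2 (R : realType) (n : nat) (hn : (2 <= n)%N)
    (Omega : set 'rV[R]_n) (hOmega : hyp_bounded_domain Omega)
    (u v : 'rV[R]_n -> R)
    (u_C0 : {within hyp_closure Omega, continuous u})
    (v_C0 : {within hyp_closure Omega, continuous v})
    (u_C2 : C2_on Omega u) (v_C2 : C2_on Omega v)
    (u_sl : space_like Omega u) (v_sl : space_like Omega v)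
    (u_tr : translator Omega u) (v_tr : translator Omega v)
    (uv_bd : forall x, hyp_boundary Omega x -> u x = v x) :
  forall x, Omega x -> u x = v x.
Proof.
(* The perturbation varies along coordinate 0; the two inequalities follow from one another by
   exchanging [u] and [v]. *)
pose k : 'I_n := Ordinal (ltnW hn).
move=> x Ox; apply/eqP; rewrite eq_le; apply/andP; split.
  exact: (translator_le Omega u v k).
by apply: (translator_le Omega v u k) => // y /uv_bd.
Qed.
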